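(* Let $\mathbb{F}_q$ be a finite field with $q$ elements, $q$ odd, and let $G=\mathrm{SL}_2(\mathbb{F}_q)$. (a) Let $V=\mathrm{Ind}_B^G B_0=G_0\oplus V_q$ be the $G$-module over $\mathbb{C}$ induced from the trivial module $B_0$ of the Borel subgroup $B$ of upper-triangular matrices in $G$. Then $$\dim (V^{\otimes k})^G=\begin{cases}1&\text{when }k=0,\\ \dfrac{1}{q(q-1)}\left(2(q+1)^{k-1}+q(q-3)\cdot2^{k-1}+2(q-1)\right)&\text{when }k\ge1.\end{cases}$$ The Poincaré series for the $G$-invariants in $\bigoplus_{k\ge0}V^{\otimes k}$ is $$\sum_{k=0}^\infty\dim (V^{\otimes k})^G\,t^k=\frac{1-(q+3)t+(2q+3)t^2-(q-1)t^3}{(1-t)(1-2t)(1-(q+1)t)}.$$ (b) For the Steinberg module $V_q$, $\dim (V_q^{\otimes k})^G=1$ when $k=0$, and when $k\ge1$, $$\dim (V_q^{\otimes k})^G=\frac1{2(q^2-1)}\left(4q^{k-1}+(q-1)^2(-1)^k+(q-3)(q+1)\right)$$ $$=\begin{cases}\dfrac{2(q^{2\ell}-1)}{q^2-1}=2\displaystyle\sum_{j=0}^{\ell-1}q^{2j}&\text{if }k=2\ell+1\ge1,\\[8pt] 1+2q\,\dfrac{q^{2\ell-2}-1}{q^2-1}=1+2\displaystyle\sum_{j=0}^{\ell-2}q^{2j+1}&\text{if }k=2\ell\ge2.\end{cases}$$ The Poincaré series for the $G$-invariants in $\bigoplus_{k\ge0}V_q^{\otimes k}$ is $$\sum_{k=0}^\infty\dim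 (V_q^{\otimes k})^G\,t^k=\frac{1-qt+2t^3}{(1+t)(1-t)(1-qt)}.$$
   Context: $G_0$ denotes the trivial one-dimensional complex $G$-module. The induced module $V=\mathbb{C}[G]\otimes_{\mathbb{C}[B]}B_0$ has dimension $q+1$ and decomposes as $V=G_0\oplus V_q$, where $V_q$ is an irreducible $q$-dimensional $G$-module, the Steinberg module. For a $G$-module $W$, $W^G$ is its space of $G$-invariants. Empty sums are $0$. *)

(* Defs.v *)
From mathcomp Require Import all_boot all_order all_algebra all_fingroup.
From mathcomp Require Import all_solvable all_field all_character.
From mathcomp Require Import reals complex.

Set Implicit Arguments.
Unset Strict Implicit.
Unset Printing Implicit Defensive.

Import Order.TTheory GRing.Theory Num.Theory.
Local Open Scope ring_scope.

(* A G-module of dimension n is a [mx_representation C G n], acting on row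
   vectors, hence on the right; the left module is x . v = v x^-1. *)

Fact triv_mx_repr (C : fieldType) (gT : finGroupType) (G : {group gT}) n :
  mx_repr G (fun _ : gT => 1%:M : 'M[C]_n).
Proof. by split=> // x y _ _; rewrite mulmx1. Qed.

Definition triv_repr (C : fieldType) (gT : finGroupType) (G : {group gT}) n :
    mx_representation C G n :=
  MxRepresentation (@triv_mx_repr C gT G n).

Definition triv_grepr (C : fieldType) (gT : finGroupType) (G : {group gT}) :
    representation C G :=
  Representation (@triv_repr C gT G 1).

Fixpoint tensor_power (C : fieldType) (gT : finGroupType) (G : {group gT})
    (W : representation C G) (k : nat) : representation C G :=
  if k is k'.+1 then Representation (prod_repr W (tensor_power W k'))
  else triv_grepr C G.

Definition dim_invariants (C : fieldType) (gT : finGroupType) (G : {group gT})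
    (W : representation C G) : nat :=
  \rank (rfix_mx W G).

(* The module induced from an H-module W is W (x)_{C[H]} C[G], the right-handed
   form of C[G] (x)_{C[H]} W.  It is the quotient of W (x)_C C[G], on which G
   acts through the second factor, by the span of all
   w b (x) x - w (x) b x  for w in W, b in H, x in G. *)

Definition lmul_mx (C : fieldType) (gT : finGroupType) (G : {group gT}) b :
    'M[C]_(gcard G) :=
  \matrix_i delta_mx 0 (gring_index G (b * enum_val i)%g).

Definition free_ind_repr (C : fieldType) (gT : finGroupType) (G : {group gT})
    m : mx_representation C G (m * gcard G) :=
  prod_repr (triv_repr C G m) (regular_repr C G).

Definition ind_relations (C : fieldType) (gT : finGroupType)
    (G H : {group gT}) m (rW : mx_representation C H m) :
    'M[C]_(m * gcard G) :=
  (\sum_(b in H) (tprod (rW b) 1%:M - tprod 1%:M (lmul_mx C G b)))%MS.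

Lemma lmul_regularC (C : fieldType) (gT : finGroupType) (G : {group gT}) b x :
  b \in G -> x \in G ->
  lmul_mx C G b *m regular_repr C G x = regular_repr C G x *m lmul_mx C G b.
Proof.
move=> Gb Gx; apply/row_matrixP=> i; rewrite !row_mul !rowK -!rowE !rowK.
by rewrite !gring_indexK ?groupM ?enum_valP // mulgA.
Qed.

Lemma ind_relations_module (C : fieldType) (gT : finGroupType)
    (G H : {group gT}) m (rW : mx_representation C H m) :
  H \subset G -> mxmodule (free_ind_repr C G m) (ind_relations G rW).
Proof.
move=> sHG; apply: sumsmx_module => b Hb.
apply/mxmoduleP=> x Gx.
have Gb := subsetP sHG b Hb.
have -> : free_ind_repr C G m x = tprod 1%:M (regular_repr C G x) by [].
rewrite mulmxBl -!tprodE mulmx1 mul1mx lmul_regularC //.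
rewrite -[X in tprod X (regular_repr _ _ _)]mul1mx.
by rewrite -{1}[regular_repr C G x]mulmx1 !tprodE -mulmxBr submxMl.
Qed.

Definition ind_grepr (C : fieldType) (gT : finGroupType) (G H : {group gT})
    (sHG : H \subset G) m (rW : mx_representation C H m) :
    representation C G :=
  Representation (factmod_repr (ind_relations_module rW sHG)).

Fact SL2_group_set (F : finFieldType) :
  group_set [set g : {'GL_2[F]} | \det (GLval g) == 1].
Proof.
apply/group_setP; split=> [|g h]; rewrite !inE ?GL_1E ?det1 // => /eqP dg /eqP dh.
by rewrite GL_MxE det_mulmx dg dh mulr1.
Qed.

Definition SL2 (F : finFieldType) : {group {'GL_2[F]}} :=
  Group (SL2_group_set F).

Fact borel_group_set (F : finFieldType) :
  group_set [set g in SL2 F | GLval g ord_max ord0 == 0].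
Proof.
apply/group_setP; split=> [|g h].
  by rewrite !inE GL_1E det1 mxE !eqxx.
rewrite !inE => /andP[/eqP dg /eqP g0] /andP[/eqP dh /eqP h0].
rewrite GL_MxE det_mulmx dg dh mulr1 eqxx /= mxE big_ord_recr big_ord1 /=.
rewrite h0 mulr0 addr0 (_ : widen_ord _ _ = ord0) ?g0 ?mul0r //.
exact: val_inj.
Qed.

Definition borel (F : finFieldType) : {group {'GL_2[F]}} :=
  Group (borel_group_set F).

Fact borel_sub (F : finFieldType) : borel F \subset SL2 F.
Proof. by apply/subsetP=> g /setIdP[]. Qed.

Definition ind_borel (C : fieldType) (F : finFieldType) :
    representation C (SL2 F) :=
  ind_grepr (borel_sub F) (triv_repr C (borel F) 1).

(* W is any model of the complement V_q in V = G_0 + V_q: it is determined up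
   to isomorphism by Krull-Schmidt, and exists by [steinberg_exists]. *)
Definition is_steinberg (C : fieldType) (F : finFieldType)
    (W : representation C (SL2 F)) : Prop :=
  mx_rsim (ind_borel C F) (dadd_grepr (triv_grepr C (SL2 F)) W).

(* The formal power series \sum_n a n t^n equals the fraction N / D, i.e. its
   Cauchy product with D is N, where D is invertible as a power series. *)
Definition series_eq_frac (K : fieldType) (a : nat -> K) (N D : {poly K}) :
    Prop :=
  D`_0 != 0 /\ forall n, \sum_(i < n.+1) a i * D`_(n - i) = N`_n.

Lemma free_ind_augmentation (C : fieldType) (gT : finGroupType)
    (G : {group gT}) x :
  x \in G -> let c := tprod (1%:M : 'M[C]_1) (const_mx 1 : 'cV_(gcard G)) in
  free_ind_repr C G 1 x *m c = c.
Proof.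
move=> Gx c; rewrite /c.
have -> : free_ind_repr C G 1 x = tprod 1%:M (regular_repr C G x) by [].
rewrite -tprodE mulmx1; congr tprod; apply/row_matrixP=> i.
by rewrite row_mul rowK -rowE; apply/rowP=> j; rewrite !mxE.
Qed.

Lemma ind_triv_split (C : numFieldType) (gT : finGroupType) (G H : {group gT})
    (sHG : H \subset G) :
  exists W : representation C G,
    mx_rsim (ind_grepr sHG (triv_repr C H 1)) (dadd_grepr (triv_grepr C G) W).
Proof.
set V := ind_grepr _ _.
pose U := ind_relations G (triv_repr C H 1).
pose c0 := tprod (1%:M : 'M[C]_1) (const_mx 1 : 'cV_(gcard G)).
have Uc0 : (U <= kermx c0)%MS.
  apply/sumsmx_subP=> b Hb; apply/sub_kermxP.
  rewrite mulmxBl -!tprodE !mul1mx; apply/eqP; rewrite subr_eq0; apply/eqP.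
  congr tprod; apply/row_matrixP=> i.
  by rewrite row_mul rowK -rowE; apply/rowP=> j; rewrite !mxE.
have valin m (A : 'M[C]_(m, _)) : val_factmod (in_factmod U A) *m c0 = A *m c0.
  rewrite -[in RHS](add_sub_fact_mod U A) mulmxDl.
  by rewrite (sub_kermxP (submx_trans (val_submodP _) Uc0)) add0r.
pose c := val_factmod (U := U) 1%:M *m c0.
have inc m (A : 'M[C]_(m, _)) : in_factmod U A *m c = A *m c0.
  by rewrite mulmxA -val_factmodE valin.
have Vc x : x \in G -> V x *m c = c.
  move=> Gx; have -> : V x = in_factmod U (val_factmod (U := U) 1%:M *m free_ind_repr C G 1 x) by [].
  by rewrite inc -mulmxA free_ind_augmentation.
have c0n0 : c0 != 0.
  apply/eqP=> c00; have: c0 *m 1%:M = 0 by rewrite c00 mul0mx.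
  pose r := tprod (1%:M : 'M[C]_1) (delta_mx 0 (gring_index G 1%g) : 'rV_(gcard G)).
  have: r *m c0 = 1%:M.
    rewrite -tprodE mulmx1 -rowE [row _ _](_ : _ = 1%:M) ?tprod1 //.
    by apply/matrixP=> i j; rewrite !mxE !ord1.
  by rewrite c00 mulmx0 => /eqP; rewrite eq_sym oner_eq0.
have cn0 : c != 0.
  apply: contraNneq c0n0 => c00; rewrite -[c0]mul1mx -inc c00 mulmx0 //.
have modK : mxmodule V (kermx c).
  by apply/mxmoduleP=> x Gx; apply/sub_kermxP; rewrite -mulmxA Vc ?mulmx_ker.
have charG : (([pchar C]^').-group G)%g.
  by apply/andP; split=> //; apply/allP=> p _; rewrite inE /= pchar_num.
have [T modT defT dxT] := mx_Maschke_pchar V charG modK (submx1 _).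
have tiKT := mxdirect_addsP dxT.
have rkc : \rank c = 1%N by apply/eqP; rewrite eqn_leq rank_leq_col lt0n mxrank_eq0.
have rkT : \rank T = 1%N.
  have := mxdirectP dxT; rewrite /= defT mxrank1 mxrank_ker rkc => e.
  by have := rank_leq_row c; rewrite rkc => n0; apply/eqP;
    rewrite -(eqn_add2l (rdegree V - 1)) -e subnK.
exists (Representation (submod_repr modK)).
have simT : mx_rsim (submod_repr modT) (triv_grepr C G).
  exists (val_submod 1%:M *m c) => // [|x Gx].
    rewrite /row_free eqn_leq rank_leq_row [X in (X <= _)%N]rkT /=.
    rewrite lt0n mxrank_eq0.
    apply/negP=> /eqP/sub_kermxP; rewrite val_submod1 => sTK.
    have T0 : T = 0 by apply/eqP; rewrite -submx0 -tiKT sub_capmx sTK submx_refl.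
    by move: rkT; rewrite T0 mxrank0.
  rewrite mulmxA -val_submodE -[submod_repr _ x]mul1mx val_submodJ //.
  by rewrite -(mulmxA _ (V x) c) Vc // [RHS]mulmx1.
apply: mx_rsim_trans (mx_rsim_sym (rsim_submod1 (mxmodule1 V) (eqmx_refl _))) _.
have rK : mx_rsim (submod_repr modK) (Representation (submod_repr modK)).
  exact: mx_rsim_refl.
apply: (mx_rsim_dadd _ _ _ simT rK).
  by rewrite addsmxC.
by rewrite mxdirectE /= addsmxC addnC -mxdirectE.
Qed.

Lemma steinberg_exists (C : numFieldType) (F : finFieldType) :
  exists W : representation C (SL2 F), is_steinberg W.
Proof. exact: ind_triv_split. Qed.

(* Main.v *)
(* The dimension of W^G is the average over G of the trace of W (the averaging
   projector has image W^G), and traces of tensor powers are powers of traces.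
   The trace chi of the induced module V at g is #{x : x g x^-1 in B} / |B|, so
   that Frobenius reciprocity gives, for every function phi,
     sum_{g in G} chi(g) phi(chi(g)) = (q + 1) sum_{h in B} phi(chi(h)).
   On B, chi takes the value q + 1 twice (at +-1), the value 1 at the 2(q - 1)
   other elements with diagonal +-1, and the value 2 at the q(q - 3) remaining
   ones.  Taking phi(x) = x^(k-1) gives (a).  The Steinberg character is chi - 1,
   and (x - 1)^k - (-1)^k is a multiple of x, which gives (b). *)
Require Import Defs.
From mathcomp Require Import all_boot all_order all_algebra all_fingroup.
From mathcomp Require Import all_solvable all_field all_character.
From mathcomp Require Import reals complex.
From mathcomp Require Import ring.

Set Implicit Arguments.
Unset Strict Implicit.
Unset Printing Implicit Defensive.

Import Order.TTheory GRing.Theory Num.Theory.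
Local Open Scope ring_scope.
Local Open Scope complex_scope.

(** * Dimensions of invariants as averaged traces *)

(** Write [E = c *m r] with [c] of full column rank and [r] of full row rank. Cancelling both in
    [c r c r = c r] leaves [r c = 1], of size the rank, and [c r] and [r c] have the same trace. *)
Lemma mxtrace_idempotent (C : fieldType) n (E : 'M[C]_n) :
  E *m E = E -> \tr E = (\rank E)%:R.
Proof.
have := mulmx_base E; have := col_base_full E; have := row_base_free E.
move: (col_base E) (row_base E) => c r.
move=> /row_freeP[B rB] /row_fullP[A Ac] defE EE.
suff rc : r *m c = 1%:M by rewrite -{1}defE mxtrace_mulC rc mxtrace1.
have /(congr1 (fun M => A *m M *m B)) : c *m r *m (c *m r) = c *m r.
  by rewrite defE.
by rewrite !mulmxA Ac !mul1mx rB -mulmxA rB mulmx1.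
Qed.

Lemma card_group_neq0 (C : numFieldType) (gT : finGroupType) (G : {group gT}) :
  #|G|%:R != 0 :> C.
Proof. by rewrite pnatr_eq0 -lt0n cardG_gt0. Qed.

Lemma dim_invariantsE (C : numFieldType) (gT : finGroupType) (G : {group gT})
    (W : representation C G) :
  (dim_invariants W)%:R = #|G|%:R^-1 * \sum_(g in G) \tr (W g).
Proof.
set c := _^-1.
pose E := c *: \sum_(g in G) W g.
have EW x : x \in G -> E *m W x = E.
  move=> Gx; rewrite -scalemxAl mulmx_suml (reindex_inj (mulIg x^-1)%g).
  congr (_ *: _); apply: eq_big => [y|y]; first by rewrite groupMr ?groupV.
  by move=> Gy; rewrite -repr_mxM ?mulgKV // -(groupMr _ (groupVr Gx)).
(* Applied to [rfix_mx W G], this gives one inclusion of row spaces; applied to [E] itself, it gives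
   idempotence. *)
have fixE m (A : 'M_(m, _)) : (forall x, x \in G -> A *m W x = A) -> A *m E = A.
  move=> fA; rewrite -scalemxAr mulmx_sumr (eq_bigr (fun=> A)) //.
  by rewrite sumr_const -scaler_nat scalerA mulVf ?scale1r ?card_group_neq0.
have rE : (rfix_mx W G :=: E)%MS.
  apply/eqmxP; rewrite andbC; apply/andP; split; first exact/rfix_mxP.
  by rewrite -[rfix_mx _ _]fixE ?submxMl // => x; apply: rfix_mx_id.
rewrite /dim_invariants rE -mxtrace_idempotent ?fixE //.
by rewrite linearZ /= raddf_sum.
Qed.

Lemma mxtrace_tensor_power (C : fieldType) (gT : finGroupType) (G : {group gT})
    (W : representation C G) k g :
  \tr (tensor_power W k g) = \tr (W g) ^+ k.
Proof.
elim: k => [|k IHk]; first by rewrite expr0 /= mxtrace1.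
by rewrite exprS -IHk /= mxtrace_prod.
Qed.

Lemma dim_invariants_tensor_power (C : numFieldType) (gT : finGroupType)
    (G : {group gT}) (W : representation C G) k :
  (dim_invariants (tensor_power W k))%:R
    = #|G|%:R^-1 * \sum_(g in G) \tr (W g) ^+ k.
Proof.
rewrite dim_invariantsE; congr (_ * _).
by apply: eq_bigr => g _; rewrite mxtrace_tensor_power.
Qed.

Lemma mxtrace_dadd (C : fieldType) (gT : finGroupType) (G : {group gT})
    (V W : representation C G) g :
  \tr (dadd_grepr V W g) = \tr (V g) + \tr (W g).
Proof. exact: mxtrace_block. Qed.

(** * The character of a module induced from the trivial module *)

(** Row vectors meet the left matrix factor first, so left translations compose in reverse order. *)
Lemma lmul_mxM (C : fieldType) (gT : finGroupType) (G : {group gT}) b c :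
  b \in G -> c \in G -> lmul_mx C G b *m lmul_mx C G c = lmul_mx C G (c * b).
Proof.
move=> Gb Gc; apply/row_matrixP=> i; rewrite !row_mul !rowK -!rowE !rowK.
by rewrite !gring_indexK ?groupM ?enum_valP // mulgA.
Qed.

(** The product permutes the basis by x -> b x g, so its trace counts the fixed points, and b x g =
    x means b = (x g x^-1)^-1. *)
Lemma mxtrace_regular_lmul (C : fieldType) (gT : finGroupType)
    (G : {group gT}) g b : g \in G -> b \in G ->
  \tr (regular_repr C G g *m lmul_mx C G b)
    = \sum_(x in G) (b == (x * g * x^-1)^-1)%g%:R.
Proof.
move=> Gg Gb; rewrite (reindex (enum_val (A := G))) /=; last first.
  exists (gring_index G) => x; rewrite !inE; first by rewrite gring_valK.
  exact: gring_indexK.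
apply: eq_big => [i|i _]; first by rewrite enum_valP.
have Gi : enum_val i \in G := enum_valP i.
transitivity (row i (regular_mx C G g *m lmul_mx C G b) 0 i).
  by rewrite [RHS]mxE.
rewrite row_mul rowK -rowE rowK gring_indexK ?groupM // mxE eqxx /=.
congr (_%:R : C); congr nat_of_bool.
rewrite eq_sym -[X in _ == X]gring_valK.
rewrite (inj_in_eq (can_in_inj (@gring_indexK _ G))) ?groupM //.
by rewrite eq_mulgV1 [RHS]eq_mulgV1 invgK !mulgA.
Qed.

(** After exchanging the sums, each x admits at most one b, the inverse of x g x^-1, and it lies in
    H exactly when x g x^-1 does. *)
Lemma sum_mxtrace_regular_lmul (C : fieldType) (gT : finGroupType)
    (G H : {group gT}) g :
  H \subset G -> g \in G ->
  \sum_(b in H) \tr (regular_repr C G g *m lmul_mx C G b)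
    = #|[set x in G | (x * g * x^-1)%g \in H]|%:R.
Proof.
move=> sHG Gg.
under eq_bigr => b Hb do rewrite mxtrace_regular_lmul ?(subsetP sHG b Hb) //.
rewrite exchange_big /= -sum1dep_card natr_sum big_mkcondr /=.
apply: eq_bigr => x Gx.
rewrite -[in RHS]groupV /=; case: ifPn => Hx.
  rewrite (bigD1 _ Hx) /= eqxx big1 ?addr0 // => b /andP[_ /negPf->] //.
by rewrite big1 // => b Hb; case: eqP => // def_b; rewrite -def_b Hb in Hx.
Qed.

Lemma mxtrace_ind_triv (C : numFieldType) (gT : finGroupType)
    (G H : {group gT}) (sHG : H \subset G) g : g \in G ->
  \tr (ind_grepr sHG (triv_repr C H 1) g)
    = #|[set x in G | (x * g * x^-1)%g \in H]|%:R / #|H|%:R.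
Proof.
move=> Gg; pose R := free_ind_repr C G 1; pose U := ind_relations G (triv_repr C H 1).
pose L b := tprod (1%:M : 'M[C]_1) (lmul_mx C G b).
(* [P] is a projector with kernel [U] that commutes with [G], so [g] has the
   same trace on the quotient by [U] as [R g *m P]. *)
pose P := #|H|%:R^-1 *: \sum_(b in H) L b.
have LM b c : b \in G -> c \in G -> L b *m L c = L (c * b)%g.
  by move=> Gb Gc; rewrite /L -tprodE mulmx1 lmul_mxM.
have LP b : b \in H -> L b *m P = P.
  move=> Hb; rewrite /P -scalemxAr mulmx_sumr [in RHS](reindex_inj (mulIg b)) /=.
  congr (_ *: _); apply: eq_big => [c|c Hc]; first by rewrite groupMr.
  by rewrite LM ?(subsetP sHG).
have RP : R g *m P = P *m R g.
  rewrite -scalemxAr -scalemxAl mulmx_sumr mulmx_suml; congr (_ *: _).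
  apply: eq_bigr => b Hb; rewrite -!tprodE !mulmx1.
  by rewrite lmul_regularC // (subsetP sHG).
have UP : U *m P = 0.
  apply/sub_kermxP/sumsmx_subP=> b Hb; apply/sub_kermxP.
  by rewrite -[triv_repr C H 1 b]/(1%:M) tprod1 mulmxBl mul1mx LP ?subrr.
have P1 : (1%:M - P <= U)%MS.
  have -> : 1%:M - P = #|H|%:R^-1 *: \sum_(b in H) (1%:M - L b).
    rewrite sumrB sumr_const -scaler_nat scalerBr scalerA mulVf ?scale1r //.
    exact: card_group_neq0.
  apply: scalemx_sub; apply: summx_sub_sums => b Hb.
  by rewrite -[triv_repr C H 1 b]/(1%:M) tprod1.
(* [Q] projects onto the complement of [U] that underlies the quotient, a complement which need not
   be G-stable. Since [P] and [Q] both kill [U] and are the identity modulo [U], [Q P = P] and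
   [P Q = Q]; with [P] commuting with [R g], cyclicity of the trace exchanges them. *)
pose Q := in_factmod U 1%:M *m val_factmod (U := U) 1%:M.
have QE : Q = 1%:M - val_submod (in_submod U 1%:M).
  by rewrite -[X in X - _](add_sub_fact_mod U) addrC addKr /Q -val_factmodE.
have QP : Q *m P = P.
  rewrite QE mulmxBl mul1mx [X in _ - X](_ : _ = 0) ?subr0 //.
  by have /submxP[D ->] := val_submodP (in_submod U 1%:M); rewrite -mulmxA UP mulmx0.
have PQ : P *m Q = Q.
  apply/eqP; rewrite eq_sym -subr_eq0 -[X in X - _]mul1mx -mulmxBl.
  have /submxP[D ->] := P1; rewrite -mulmxA [U *m _](_ : _ = 0) ?mulmx0 //.
  have /eqP U0 : in_factmod U U == 0 by rewrite in_factmod_eq0.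
  by rewrite mulmxA -in_factmodE U0 mul0mx.
transitivity (\tr (R g *m Q)).
  rewrite -[LHS]/(\tr (in_factmod U (val_factmod (U := U) 1%:M *m R g))).
  by rewrite in_factmodE -mulmxA mxtrace_mulC -mulmxA.
have -> : \tr (R g *m Q) = \tr (R g *m P).
  transitivity (\tr (P *m (R g *m Q))); last first.
    by rewrite mxtrace_mulC -(mulmxA (R g)) QP.
  by rewrite (mulmxA P) -RP -(mulmxA _ P) PQ.
rewrite -scalemxAr linearZ /= mulrC; congr (_ / _).
rewrite mulmx_sumr raddf_sum -sum_mxtrace_regular_lmul //; apply: eq_bigr => b _ /=.
by rewrite -tprodE mulmx1 mxtrace_prod mxtrace1 mul1r.
Qed.

(** After multiplication by |H|, the left side is a sum over pairs (g, x) with x g x^-1 in H. For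
    fixed x, put h = x g x^-1: as the trace is a class function, every x contributes the same sum
    over H. *)
Lemma sum_mxtrace_ind_triv (C : numFieldType) (gT : finGroupType)
    (G H : {group gT}) (sHG : H \subset G) (phi : C -> C) :
  let V := ind_grepr sHG (triv_repr C H 1) in
  \sum_(g in G) \tr (V g) * phi (\tr (V g))
    = #|G|%:R / #|H|%:R * \sum_(h in H) phi (\tr (V h)).
Proof.
move=> V; pose chi g := \tr (V g).
have chiJ g x : g \in G -> x \in G -> chi (g ^ x)%g = chi g.
  move=> Gg Gx; rewrite /chi conjgE !repr_mxM ?groupM ?groupV //.
  by rewrite mxtrace_mulC -mulmxA -repr_mxM ?groupV // mulgV repr_mx1 mulmx1.
rewrite mulrAC mulrC; apply: (canRL (mulKf (card_group_neq0 C H))).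
rewrite mulr_sumr (eq_bigr (fun g =>
    \sum_(x in G | (x * g * x^-1)%g \in H) phi (chi g))); last first.
  move=> g Gg; rewrite -/(chi g) {1}/chi mxtrace_ind_triv // mulrA.
  rewrite [#|H|%:R * _]mulrC divfK ?card_group_neq0 //.
  by rewrite sumr_const mulr_natl; congr (_ *+ _); apply: eq_card => x; rewrite inE.
rewrite (exchange_big_dep (mem G)) //=; last by move=> g x _ /andP[].
rewrite mulr_natl -sumr_const; apply: eq_bigr => x Gx.
rewrite (reindex_inj (conjg_inj x)) /=; apply: eq_big => [h|h].
  rewrite groupJr // Gx conjgE !mulgA mulgV mul1g mulgK andbC.
  by apply: andb_idr => /(subsetP sHG).
by rewrite groupJr // => /andP[Gh _]; rewrite -/(chi h) chiJ.
Qed.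

(** * Coordinates on SL2 and on its Borel subgroup *)

Lemma det_mx22 (R : comNzRingType) (A : 'M[R]_2) :
  \det A = A 0 0 * A 1 1 - A 0 1 * A 1 0.
Proof.
have I01 : lift ord0 ord0 = 1 :> 'I_2 by apply: val_inj.
have I10 : lift 1 ord0 = 0 :> 'I_2 by apply: val_inj.
rewrite (expand_det_row _ 0) big_ord_recl big_ord1 I01 /cofactor !det_mx11 !mxE.
by rewrite I01 I10 addn0 add0n expr0 expr1 mul1r mulN1r mulrN.
Qed.

Section SL2.

Variable F : finFieldType.
Implicit Types (a b c d : F) (g h x : {'GL_2[F]}).

(** The identity is only a default for singular matrices; the lemmas below that compute with given
    entries assume determinant 1. *)
Definition gl2 a b c d : {'GL_2[F]} :=
  insubd (1%g : {'GL_2[F]}) (\matrix_(i < 2, j < 2)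
    if i == 0 then if j == 0 then a else b else if j == 0 then c else d).

Lemma gl2E a b c d : a * d - b * c = 1 ->
  [/\ GLval (gl2 a b c d) 0 0 = a, GLval (gl2 a b c d) 0 1 = b,
      GLval (gl2 a b c d) 1 0 = c & GLval (gl2 a b c d) 1 1 = d].
Proof.
move=> det1; rewrite /gl2; set M := \matrix_(i, j) _.
have UM : M \is a GRing.unit.
  suff: M \in unitmx by [].
  by rewrite unitmxE unitfE det_mx22 !mxE /= det1 oner_eq0.
have -> : GLval (insubd (1%g : {'GL_2[F]}) M) = M by exact: insubdK.
by rewrite !mxE.
Qed.

Lemma SL2P g : reflect (GLval g 0 0 * GLval g 1 1 - GLval g 0 1 * GLval g 1 0 = 1)
  (g \in SL2 F).
Proof.
rewrite inE det_mx22; exact: eqP.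
Qed.

Lemma borelE g : (g \in borel F) = (g \in SL2 F) && (GLval g 1 0 == 0).
Proof.
rewrite 2!inE; congr (_ && (GLval g _ _ == _)); exact: val_inj.
Qed.

Lemma gl2_SL2 a b c d : a * d - b * c = 1 -> gl2 a b c d \in SL2 F.
Proof. by move=> det1; apply/SL2P; case: (gl2E det1) => -> -> -> ->. Qed.

Lemma gl2_borel a b c d : a * d - b * c = 1 ->
  (gl2 a b c d \in borel F) = (c == 0).
Proof.
by move=> det1; rewrite borelE gl2_SL2 //; case: (gl2E det1) => _ _ ->.
Qed.

Lemma GL2_ext g h : GLval g 0 0 = GLval h 0 0 -> GLval g 0 1 = GLval h 0 1 ->
  GLval g 1 0 = GLval h 1 0 -> GLval g 1 1 = GLval h 1 1 -> g = h.
Proof.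
move=> e00 e01 e10 e11; apply: val_inj; apply/matrixP=> i j /=.
have I2 (k : 'I_2) : k = 0 \/ k = 1.
  by case: k => [[|[]]] // p; [left | right]; apply: val_inj.
by case: (I2 i) => ->; case: (I2 j) => ->.
Qed.

Lemma gl2M a b c d a' b' c' d' : a * d - b * c = 1 -> a' * d' - b' * c' = 1 ->
  (gl2 a b c d * gl2 a' b' c' d')%g
    = gl2 (a * a' + b * c') (a * b' + b * d') (c * a' + d * c') (c * b' + d * d').
Proof.
move=> det1 det1'.
have det1'' : (a * a' + b * c') * (c * b' + d * d')
    - (a * b' + b * d') * (c * a' + d * c') = 1.
  by rewrite -[1](mulr1) -{1}det1 -det1'; ring.
case: (gl2E det1) (gl2E det1') (gl2E det1'') => e1 e2 e3 e4 [f1 f2 f3 f4] [k1 k2 k3 k4].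
have I01 : lift ord0 ord0 = 1 :> 'I_2 by apply: val_inj.
by apply: GL2_ext; rewrite GL_MxE mxE big_ord_recl big_ord1 I01
  ?(k1, k2, k3, k4) !(e1, e2, e3, e4, f1, f2, f3, f4).
Qed.

Lemma gl2V a b c d : a * d - b * c = 1 -> (gl2 a b c d)^-1%g = gl2 d (- b) (- c) a.
Proof.
move=> det1.
have det1' : d * a - (- b) * (- c) = 1 by rewrite -det1; ring.
apply/eqP; rewrite eq_invg_mul gl2M //; apply/eqP.
have det11 : 1 * 1 - 0 * 0 = 1 :> F by rewrite mulr1 mulr0 subr0.
rewrite [a * d + _](_ : _ = 1); last by rewrite -det1; ring.
rewrite [c * - b + _](_ : _ = 1); last by rewrite -det1; ring.
rewrite [_ + b * a](_ : _ = 0); last by ring.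
rewrite [_ + d * - c](_ : _ = 0); last by ring.
by case: (gl2E det11) => e1 e2 e3 e4; apply: GL2_ext; rewrite GL_1E mxE ?(e1, e2, e3, e4).
Qed.

Lemma gl2K g : g \in SL2 F ->
  gl2 (GLval g 0 0) (GLval g 0 1) (GLval g 1 0) (GLval g 1 1) = g.
Proof.
by move=> /SL2P det1; case: (gl2E det1) => *; apply: GL2_ext.
Qed.

Local Notation q := #|F|.

Definition upper a b := gl2 a b 0 a^-1.

Lemma upper_det a b : a != 0 -> a * a^-1 - b * 0 = 1.
Proof. by move=> a0; rewrite mulfV // mulr0 subr0. Qed.

(** Determinant 1 forces the diagonal to be (a, a^-1), so B is parametrized by a nonzero and b
    arbitrary. *)
Lemma sum_borel (V : nmodType) (f : {'GL_2[F]} -> V) :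
  \sum_(h in borel F) f h = \sum_(a | a != 0) \sum_b f (upper a b).
Proof.
pose m (p : F * F) := upper p.1 p.2; pose m' g := (GLval g 0 0, GLval g 0 1).
rewrite pair_big (eq_bigl (fun p => p.1 != 0)) => [|p]; last by rewrite /= andbT.
rewrite (eq_bigr (fun p => f (m p))) //.
rewrite [RHS](reindex_onto m' m) => [|[a b] /= a0]; last first.
  by case: (gl2E (upper_det b a0)) => e1 e2 _ _; rewrite /m' e1 e2.
have mK h : h \in borel F -> GLval h 0 0 != 0 /\ m (m' h) = h.
  rewrite borelE => /andP[Gh /eqP h10].
  have /SL2P := Gh; rewrite h10 mulr0 subr0 => h00.
  have n0 : GLval h 0 0 != 0.
    by apply: contra_eq_neq h00 => ->; rewrite mul0r eq_sym oner_eq0.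
  split=> //; rewrite -[RHS]gl2K // /m /upper /= h10; congr gl2.
  by apply: (mulfI n0); rewrite mulfV.
apply: eq_big => [h|h /mK[_ ->]] //.
apply/idP/andP => [/mK[h00 ->] //|[/= h00 /eqP <-]].
by rewrite gl2_borel ?eqxx // upper_det.
Qed.

(** On the big cell, where c is nonzero, the determinant equation can be solved for the upper right
    entry, leaving a and d free. *)
Lemma sum_SL2_lower (V : nmodType) (f : {'GL_2[F]} -> V) :
  \sum_(x in SL2 F | GLval x 1 0 != 0) f x
    = \sum_(c | c != 0) \sum_a \sum_d f (gl2 a ((a * d - 1) / c) c d).
Proof.
have det1 a c d : c != 0 -> a * d - (a * d - 1) / c * c = 1.
  by move=> c0; rewrite divfK // opprB addrCA subrr addr0.
pose m (p : F * (F * F)) := gl2 p.2.1 ((p.2.1 * p.2.2 - 1) / p.1) p.1 p.2.2.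
pose m' x : F * (F * F) := (GLval x 1 0, (GLval x 0 0, GLval x 1 1)).
under [RHS]eq_bigr => c _ do rewrite pair_big.
rewrite pair_big (eq_bigl (fun p => p.1 != 0)) => [|p]; last by rewrite /= andbT.
rewrite (eq_bigr (fun p => f (m p))) //.
rewrite [RHS](reindex_onto m' m) => [|[c [a d]] /= c0]; last first.
  by case: (gl2E (det1 a c d c0)) => e1 _ e3 e4; rewrite /m' e1 e3 e4.
have mK x : x \in SL2 F -> GLval x 1 0 != 0 -> m (m' x) = x.
  move=> Gx c0; rewrite -[RHS]gl2K // /m /=; congr gl2.
  by apply: (canLR (mulfK c0)); move/SL2P: Gx => <-; ring.
apply: eq_big => [x|x /andP[Gx c0]]; last by rewrite mK.
apply/andP/andP => -[Gx c0]; first by rewrite mK //= c0.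
by split=> //; rewrite -(eqP c0) gl2_SL2 ?det1.
Qed.

(** * Counting fixed points on the projective line *)

Lemma card_borel : #|borel F| = (q.-1 * q)%N.
Proof.
rewrite -sum1_card sum_borel; under eq_bigr => a _ do rewrite sum1_card.
by rewrite sum_nat_const cardC1.
Qed.

(** The right side is the lower left entry of the conjugate. The remaining goals check that the
    products involved have determinant 1, by multiplicativity. *)
Lemma upper_conj_borel a b x : a != 0 -> x \in SL2 F ->
  ((x * upper a b * x^-1)%g \in borel F)
    = (GLval x 1 0 * (GLval x 1 1 * (a - a^-1) - GLval x 1 0 * b) == 0).
Proof.
move=> a0 Gx; rewrite -{1 2}(gl2K Gx).
move/SL2P: Gx; move: (GLval x 0 0) (GLval x 0 1) (GLval x 1 0) (GLval x 1 1).
move=> {x} a' b' c d det1.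
have det1' := upper_det b a0.
rewrite gl2V // !gl2M //.
- rewrite gl2_borel; first by congr (_ == _); ring.
  transitivity ((a' * d - b' * c) * ((a' * d - b' * c) * (a * a^-1 - b * 0))).
    by ring.
  by rewrite det1 det1' !mulr1.
- transitivity ((a' * d - b' * c) * (a * a^-1 - b * 0)); first by ring.
  by rewrite det1 det1' mulr1.
by rewrite mulrNN (mulrC d).
Qed.

(** The elements x with c = 0 form B and all qualify. On the big cell, c can be divided out of the
    criterion: a linear condition on d remains, and the free upper left entry gives the factor q. *)
Lemma card_upper_conj a b : a != 0 ->
  #|[set x in SL2 F | (x * upper a b * x^-1)%g \in borel F]|
    = (#|borel F|
       + \sum_(c | c != 0%R) q * #|[pred d | (d * (a - a^-1) == c * b)%R]|)%N.
Proof.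
move=> a0.
transitivity (\sum_(x in SL2 F
    | (GLval x 1 0 * (GLval x 1 1 * (a - a^-1) - GLval x 1 0 * b) == 0)%R) 1)%N.
  rewrite -sum1dep_card; apply: eq_bigl => x; apply: andb_id2l => Gx.
  exact: upper_conj_borel.
rewrite (bigID (fun x => GLval x 1 0 == 0)); congr (_ + _)%N.
  rewrite -sum1_card; apply: eq_bigl => x; rewrite borelE -andbA.
  apply: andb_id2l => _; have [->|] := eqVneq (GLval x 1 0) 0; last by rewrite andbF.
  by rewrite mul0r eqxx.
transitivity (\sum_(x in SL2 F | (GLval x 1 0 != 0)%R)
    (GLval x 1 1 * (a - a^-1) == GLval x 1 0 * b)%R)%N.
  rewrite [RHS]big_mkcond [LHS]big_mkcond; apply: eq_bigr => x _.
  have [_|_] := boolP (x \in SL2 F); last by [].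
  by rewrite mulf_eq0 subr_eq0; case: (_ == 0) => //; case: (_ == _).
rewrite sum_SL2_lower; apply: eq_bigr => c c0.
rewrite -[q]/#|[pred x : F | true]| -sum_nat_const; apply: eq_bigr => a' _.
rewrite -sum1_card [RHS]big_mkcond /=; apply: eq_bigr => d _.
have det1 : a' * d - (a' * d - 1) / c * c = 1.
  by rewrite divfK // opprB addrCA subrr addr0.
by case: (gl2E det1) => _ _ -> ->; rewrite inE; case: (_ == _).
Qed.

(* The number of fixed points of [upper a b] on the projective line [G / B]. *)
Definition borel_fix a b : nat :=
  if a == a^-1 then if b == 0 then q.+1 else 1%N else 2%N.

Lemma card_upper_conjE a b : a != 0 ->
  #|[set x in SL2 F | (x * upper a b * x^-1)%g \in borel F]|
    = (#|borel F| * borel_fix a b)%N.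
Proof.
move=> a0; rewrite card_upper_conj //.
(* The 1 is the point fixed by all of B, coming from c = 0. For each nonzero c the linear equation
   in d has q, 0 or 1 solutions, which is [(borel_fix a b).-1]; summing over c gives the factor q(q
   - 1) = |B|. *)
suff -> : borel_fix a b = (1 + (borel_fix a b).-1)%N.
  rewrite mulnDr muln1 {3}card_borel -mulnA -(cardC1 0) -sum_nat_const.
  congr (_ + _)%N; apply: eq_bigr => c c0; congr (_ * _)%N.
  rewrite /borel_fix -subr_eq0; have [d0|d0] := eqVneq (a - a^-1) 0.
    have [b0|b0] := eqVneq b 0.
      by rewrite /= cardT; apply: eq_cardT => d; rewrite !inE d0 b0 !mulr0 eqxx.
    rewrite /=; apply: eq_card0 => d; rewrite !inE d0 mulr0 eq_sym mulf_eq0.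
    by rewrite (negPf c0) (negPf b0).
  rewrite -(card1 (c * b / (a - a^-1))); apply: eq_card => d; rewrite !inE.
  by apply/eqP/eqP => [<-|->]; rewrite ?mulfK ?divfK.
by rewrite /borel_fix; do 2?case: ifP.
Qed.

Lemma upper_1_0 : upper 1 0 = 1%g.
Proof.
case: (gl2E (upper_det 0 (oner_neq0 F))) => e1 e2 e3 e4.
by apply: GL2_ext; rewrite GL_1E mxE ?(e1, e2, e3, e4) ?invr1.
Qed.

(** Apply the fixed-point count to the identity: all x qualify, and all q + 1 points are fixed. *)
Lemma card_SL2 : #|SL2 F| = (#|borel F| * q.+1)%N.
Proof.
have := card_upper_conjE 0 (oner_neq0 F); rewrite /borel_fix invr1 !eqxx => <-.
by apply: eq_card => x; rewrite upper_1_0 inE mulg1 mulgV group1 andbT.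
Qed.

Lemma mxtrace_ind_borel (C : numFieldType) a b : a != 0 ->
  \tr (ind_borel C F (upper a b)) = (borel_fix a b)%:R.
Proof.
move=> a0; have Bab : upper a b \in borel F by rewrite gl2_borel ?eqxx // upper_det.
rewrite mxtrace_ind_triv ?(subsetP (borel_sub F)) // card_upper_conjE //.
by rewrite natrM mulrAC mulfV ?card_group_neq0 // mul1r.
Qed.

(** * Character sums for odd q and the dimension formulas *)

Hypothesis odd_q : odd q.

(** The additive group has order q, so q copies of 1 sum to 0; if 2 = 0 and q is odd, this sum is
    1. *)
Lemma neq1N1 : 1 != -1 :> F.
Proof.
rewrite -subr_eq0 opprK -mulr2n; apply/eqP => F2.
have /= : (1 : F) *+ q = 0.
  by rewrite -cardsT -FinRing.Theory.zmodXgE expg_cardG ?inE.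
rewrite -(odd_double_half q) odd_q mulrnDr -muln2 mulnC mulrnA F2 mul0rn addr0.
by move/eqP; rewrite oner_eq0.
Qed.

Lemma sum_borel_mxtrace (C : numFieldType) (phi : C -> C) :
  \sum_(h in borel F) phi (\tr (ind_borel C F h))
    = 2 * phi (q%:R + 1) + 2 * (q%:R - 1) * phi 1 + q%:R * (q%:R - 3) * phi 2.
Proof.
rewrite sum_borel; under eq_bigr => a a0.
  under eq_bigr => b _ do rewrite mxtrace_ind_borel //.
  over.
have q1 : (0 < q)%N by apply/card_gt0P; exists 0.
have qE : q%:R - 1 = q.-1%:R :> C by rewrite -subn1 natrB.
have N10 : -1 != 0 :> F by rewrite oppr_eq0 oner_eq0.
(* The case a = 1 or a = -1: b = 0 gives a central element fixing q + 1 points, and each of the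
   other q - 1 values of b gives one fixed point. *)
have fix1 a : a == a^-1 -> \sum_b phi (borel_fix a b)%:R
    = phi (q%:R + 1) + (q%:R - 1) * phi 1.
  move=> aV; rewrite (bigD1 0) //= /borel_fix aV eqxx -natr1; congr (_ + _).
  rewrite (eq_bigr (fun=> phi 1)) => [|b /negPf-> //].
  by rewrite sumr_const cardC1 qE mulr_natl.
rewrite (bigD1 1) ?oner_eq0 //= fix1 ?invr1 //.
rewrite (bigD1 (-1)) ?N10 1?eq_sym ?neq1N1 //= fix1 ?invrN1 //.
rewrite (eq_bigr (fun=> q%:R * phi 2)) => [|a /andP[/andP[a0 a1] aN1]]; last first.
  have /negPf aV : a != a^-1.
    apply: contraNneq aN1 => aV; have: a ^+ 2 == 1 by rewrite expr2 {2}aV mulfV.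
    by rewrite sqrf_eq1 (negPf a1).
  by rewrite /borel_fix aV sumr_const mulr_natl.
rewrite sumr_const; set n := #|_|.
(* The remaining a avoid the three elements 0, 1, -1, distinct because q is odd; counting with + 3
   avoids truncated subtraction. *)
have cardE : (n + 3)%N = q.
  have /card_uniqP s3 : uniq [:: 0; 1; -1 : F].
    by rewrite /= !inE negb_or eq_sym oner_eq0 eq_sym N10 neq1N1.
  rewrite -(cardC (mem [:: 0; 1; -1 : F])) s3 addnC; congr (_ + _)%N.
  by apply: eq_card => a; rewrite !inE !negb_or andbA.
have -> : q%:R - 3 = n%:R :> C by rewrite -{1}cardE natrD addrK.
ring.
Qed.

Lemma sum_SL2_mxtrace (C : numFieldType) (phi : C -> C) (Q := q%:R : C) :
  \sum_(g in SL2 F) \tr (ind_borel C F g) * phi (\tr (ind_borel C F g))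
    = (Q + 1) * (2 * phi (Q + 1) + 2 * (Q - 1) * phi 1 + Q * (Q - 3) * phi 2).
Proof.
rewrite sum_mxtrace_ind_triv sum_borel_mxtrace card_SL2 natrM -natr1.
by rewrite [_ * (_ + _) / _]mulrAC mulfV ?card_group_neq0 ?mul1r.
Qed.

Lemma natr_card_field_neq (C : numFieldType) (Q := q%:R : C) :
  [/\ Q != 0, Q - 1 != 0 & Q + 1 != 0].
Proof.
have qg1 : (1 < q)%N by apply: finNzRing_gt1.
split; first by rewrite pnatr_eq0 -lt0n ltnW.
  by rewrite subr_eq0 pnatr_eq1 gtn_eqF.
by rewrite natr1 pnatr_eq0.
Qed.

Lemma card_SL2E (C : numFieldType) (Q := q%:R : C) :
  #|SL2 F|%:R = Q * (Q - 1) * (Q + 1).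
Proof.
have q1 : (0 < q)%N by apply/card_gt0P; exists 0.
rewrite card_SL2 card_borel !natrM -subn1 natrB // -natr1 -/Q.
by ring.
Qed.

Lemma dim_invariants_ind_borel (C : numFieldType) k (Q := q%:R : C) :
  (dim_invariants (tensor_power (ind_borel C F) k.+1))%:R
    = (2 * (Q + 1) ^+ k + Q * (Q - 3) * 2 ^+ k + 2 * (Q - 1)) / (Q * (Q - 1)).
Proof.
have [q0 qm1 qp1] := natr_card_field_neq C.
rewrite dim_invariants_tensor_power; under eq_bigr do rewrite exprS.
rewrite (sum_SL2_mxtrace (fun y => y ^+ k)) expr1n card_SL2E -/Q.
by field; rewrite q0 qm1 qp1.
Qed.

Lemma dim_invariants_steinberg (C : numFieldType) (W : representation C (SL2 F))
    k (Q := q%:R : C) : is_steinberg W ->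
  (dim_invariants (tensor_power W k.+1))%:R
    = (4 * Q ^+ k + (Q - 1) ^+ 2 * (-1) ^+ k.+1 + (Q - 3) * (Q + 1))
      / (2 * (Q ^+ 2 - 1)).
Proof.
move=> stW; have [q0 qm1 qp1] := natr_card_field_neq C.
have trW g : g \in SL2 F -> \tr (W g) = \tr (ind_borel C F g) - 1.
  move=> Gg; rewrite (mxtrace_rsim stW Gg) mxtrace_dadd.
  by rewrite [X in X + _ - _]mxtrace1 addrC addKr.
(* [phiE] holds at [x = 0] too, where division by zero gives [phi 0 = 0]. *)
pose phi (x : C) := ((x - 1) ^+ k.+1 - (-1) ^+ k.+1) / x.
have phiE (x : C) : (x - 1) ^+ k.+1 = (-1) ^+ k.+1 + x * phi x.
  rewrite /phi; have [->|x0] := eqVneq x 0; first by rewrite sub0r mul0r addr0.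
  by rewrite mulrC divfK // addrCA subrr addr0.
rewrite dim_invariants_tensor_power.
under eq_bigr => g Gg do rewrite trW // phiE.
have -> (f1 f2 : {'GL_2[F]} -> C) : \sum_(g in SL2 F) (f1 g + f2 g)
    = \sum_(g in SL2 F) f1 g + \sum_(g in SL2 F) f2 g by rewrite big_split.
rewrite sum_SL2_mxtrace sumr_const -[_ ^+ _ *+ _]mulr_natl card_SL2E -/Q.
(* At Q + 1, 1 and 2 the base x - 1 becomes Q, 0 and 1. The power of 0 vanishes because the exponent
   is positive. *)
rewrite /phi addrK subrr expr0n /= [2 - 1](_ : _ = 1) ?expr1n; last by ring.
rewrite !(exprS _ k) sub0r; field.
by rewrite subr_sqr_1 mulf_neq0 ?qp1 ?qm1 ?q0.
Qed.

End SL2.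

(** * Poincaré series from linear recurrences *)

(** Comparing coefficients with a cubic denominator gives four initial equations and then a
    recurrence of order 3. The recurrence involves only terms of index at least 1, so closed
    formulas for k >= 1 suffice there, and the separate value at 0 enters only the initial
    equations. *)
Lemma series_eq_frac_cubic (K : fieldType) (a : nat -> K)
    (n0 n1 n2 n3 d1 d2 d3 : K) (N D : {poly K}) :
  N = n0%:P + n1%:P * 'X + n2%:P * 'X^2 + n3%:P * 'X^3 ->
  D = 1 + d1%:P * 'X + d2%:P * 'X^2 + d3%:P * 'X^3 ->
  a 0 = n0 -> a 1 + a 0 * d1 = n1 -> a 2 + a 1 * d1 + a 0 * d2 = n2 ->
  a 3 + a 2 * d1 + a 1 * d2 + a 0 * d3 = n3 ->
  (forall n, a n.+4 + a n.+3 * d1 + a n.+2 * d2 + a n.+1 * d3 = 0) ->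
  series_eq_frac a N D.
Proof.
move=> -> -> a0 a1 a2 a3 an.
have coefs c0 c1 c2 c3 n :
    (c0%:P + c1%:P * 'X + c2%:P * 'X^2 + c3%:P * 'X^3 : {poly K})`_n
    = [:: c0; c1; c2; c3]`_n.
  rewrite !coefD !coefCM coefC coefX !coefXn.
  by case: n => [|[|[|[|n]]]]; rewrite /= ?nth_nil ?(mulr0, mulr1, addr0, add0r).
rewrite /series_eq_frac -[1]/(1%:P); split=> [|n]; first by rewrite coefs oner_eq0.
rewrite coefs; under eq_bigr do rewrite coefs.
case: n => [|[|[|[|n]]]].
- by rewrite big_ord1 /= mulr1.
- by rewrite !big_ord_recr big_ord0 /= add0r mulr1 addrC.
- by rewrite !big_ord_recr big_ord0 /= add0r mulr1 -a2; ring.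
- by rewrite !big_ord_recr big_ord0 /= add0r mulr1 -a3; ring.
(* Only the last four terms survive: in the others the index into the coefficients of [D] exceeds
   3. *)
rewrite !big_ord_recr /= !subSS subnn big1 => [|i _]; last first.
  have : (3 < n.+4 - i)%N by rewrite ltn_subRL addnC; exact: ltnW (ltn_ord i).
  by case: (_ - _)%N => [|[|[|[|m]]]] // _; rewrite /= nth_nil mulr0.
rewrite (addnK n 4 : n.+4 - n = 4)%N (addnK n 3 : n.+3 - n = 3)%N.
rewrite (addnK n 2 : n.+2 - n = 2)%N (addnK n 1 : n.+1 - n = 1)%N /= nth_nil.
by rewrite -[RHS](an n); ring.
Qed.

(** Brings the formulas, proved by traces in [C], back to the rationals in which the theorem states
    them. *)
Lemma ratr_natr_inj (C : numFieldType) (n : nat) (x : rat) :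
  n%:R = ratr x :> C -> n%:R = x.
Proof. by rewrite -ratr_nat => /fmorph_inj. Qed.

Lemma geometric_sum_even_powers (K : fieldType) (x : K) n : x ^+ 2 - 1 != 0 ->
  (x ^+ (2 * n) - 1) / (x ^+ 2 - 1) = \sum_(0 <= j < n) x ^+ (2 * j).
Proof.
move=> x1; apply: (canLR (mulfK x1)).
rewrite exprM subrX1 mulrC; congr (_ * _).
by rewrite big_mkord; apply: eq_bigr => i _; rewrite exprM.
Qed.

(** * Rational dimension formulas and the theorem *)

Section Main.

Variables (C : numFieldType) (F : finFieldType).
Hypothesis odd_q : odd #|F|.
Let q : rat := #|F|%:R.

Lemma dim_tensor_power0 (gT : finGroupType) (G : {group gT})
    (W : representation C G) :
  dim_invariants (tensor_power W 0) = 1%N.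
Proof.
apply/eqP; rewrite -(eqr_nat C) dim_invariants_tensor_power.
under eq_bigr do rewrite expr0.
by rewrite sumr_const mulVf ?card_group_neq0.
Qed.

Lemma dim_ind_borel k :
  (dim_invariants (tensor_power (ind_borel C F) k.+1))%:R
    = (2 * (q + 1) ^+ k + q * (q - 3) * 2 ^+ k + 2 * (q - 1)) / (q * (q - 1)).
Proof.
apply: (@ratr_natr_inj C); rewrite dim_invariants_ind_borel // /q.
by rewrite !(rmorph_nat, rmorph1, rmorphN1, fmorph_div, rmorphB, rmorphM,
  rmorphXn, rmorphD).
Qed.

Lemma dim_steinberg (W : representation C (SL2 F)) k : is_steinberg W ->
  (dim_invariants (tensor_power W k.+1))%:R
    = (4 * q ^+ k + (q - 1) ^+ 2 * (-1) ^+ k.+1 + (q - 3) * (q + 1))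
      / (2 * (q ^+ 2 - 1)).
Proof.
move=> stW; apply: (@ratr_natr_inj C); rewrite dim_invariants_steinberg // /q.
by rewrite !(rmorph_nat, rmorph1, rmorphN1, fmorph_div, rmorphB, rmorphM,
  rmorphXn, rmorphD).
Qed.

End Main.

Theorem theorem5p11 (R : realType) (F : finFieldType) (odd_q : odd #|F|) :
  let q : rat := #|F|%:R in
  let dimV (k : nat) : rat :=
    (dim_invariants (tensor_power (ind_borel R[i] F) k))%:R in
  (dimV 0%N = 1
   /\ (forall k : nat, (0 < k)%N ->
         dimV k = 1 / (q * (q - 1))
                  * (2 * (q + 1) ^+ k.-1 + q * (q - 3) * 2 ^+ k.-1
                     + 2 * (q - 1)))
   /\ series_eq_frac dimV
        (1 - (q + 3) *: 'X + (2 * q + 3) *: 'X^2 - (q - 1) *: 'X^3)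
        ((1 - 'X) * (1 - 2 *: 'X) * (1 - (q + 1) *: 'X)))
  /\
  (forall Vq : representation R[i] (SL2 F), is_steinberg Vq ->
   let dimVq (k : nat) : rat := (dim_invariants (tensor_power Vq k))%:R in
   dimVq 0%N = 1
   /\ (forall k : nat, (0 < k)%N ->
         dimVq k = 1 / (2 * (q ^+ 2 - 1))
                   * (4 * q ^+ k.-1 + (q - 1) ^+ 2 * (-1) ^+ k
                      + (q - 3) * (q + 1)))
   /\ (forall k l : nat, k = (2 * l + 1)%N ->
         dimVq k = 2 * (q ^+ (2 * l) - 1) / (q ^+ 2 - 1)
         /\ 2 * (q ^+ (2 * l) - 1) / (q ^+ 2 - 1)
            = 2 * \sum_(0 <= j < l) q ^+ (2 * j))
   /\ (forall k l : nat, (2 <= k)%N -> k = (2 * l)%N ->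
         dimVq k = 1 + 2 * q * ((q ^+ (2 * l - 2) - 1) / (q ^+ 2 - 1))
         /\ 1 + 2 * q * ((q ^+ (2 * l - 2) - 1) / (q ^+ 2 - 1))
            = 1 + 2 * \sum_(0 <= j < l - 1) q ^+ (2 * j + 1))
   /\ series_eq_frac dimVq
        (1 - q *: 'X + 2 *: 'X^3)
        ((1 + 'X) * (1 - 'X) * (1 - q *: 'X))).
Proof.
move=> q dimV; have [q0 qm1 qp1] := natr_card_field_neq F rat.
have q2 : q ^+ 2 - 1 != 0 by rewrite subr_sqr_1 mulf_neq0.
split=> [|{dimV} Vq stV dimV].
  have dimV0 : dimV 0 = 1 by rewrite /dimV dim_tensor_power0.
  have dimVS k : dimV k.+1
      = (2 * (q + 1) ^+ k + q * (q - 3) * 2 ^+ k + 2 * (q - 1)) / (q * (q - 1)).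
    exact: dim_ind_borel.
  split=> //; split=> [[|k] // _|]; first by rewrite dimVS mulrC mul1r.
  (* The last three constants are the coefficients of (1 - t)(1 - 2t)(1 - (q + 1)t). The recurrence
     holds because the dimension is a combination of the k-th powers of 1, 2 and q + 1. *)
  apply: (@series_eq_frac_cubic _ _ 1 (- (q + 3)) (2 * q + 3) (- (q - 1))
    (- (q + 4)) (3 * q + 5) (- (2 * (q + 1)))).
  - by rewrite -!mul_polyC; ring.
  - by rewrite -!mul_polyC; ring.
  - by [].
  - by rewrite dimVS dimV0; field; rewrite ?q0 ?qm1.
  - by rewrite !dimVS dimV0; field; rewrite ?q0 ?qm1.
  - by rewrite !dimVS dimV0; field; rewrite ?q0 ?qm1.
  by move=> n; rewrite !dimVS !exprS; field; rewrite ?q0 ?qm1.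
have dimV0 : dimV 0 = 1 by rewrite /dimV dim_tensor_power0.
have dimVS k : dimV k.+1
    = (4 * q ^+ k + (q - 1) ^+ 2 * (-1) ^+ k.+1 + (q - 3) * (q + 1))
      / (2 * (q ^+ 2 - 1)).
  exact: dim_steinberg.
split=> //; split=> [[|k] // _|]; first by rewrite dimVS mulrC mul1r.
split=> [k l ->|].
  split; last by rewrite -geometric_sum_even_powers // mulrA.
  rewrite addn1 dimVS [(-1) ^+ _]exprS [(-1) ^+ _]exprM sqrrN !expr1n.
  by field; rewrite q2.
split=> [k l k2 def_k|].
  (* The bound 2 <= k excludes l = 0, so 2l - 2 and l - 1 are true differences; after replacing l by
     l + 1 they become 2l and l. *)
  rewrite {k}def_k in k2 *; case: l k2 => [//|l _].
  rewrite mulnS addKn subn1 /=; split; last first.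
    rewrite geometric_sum_even_powers // -mulrA mulr_sumr; congr (_ + _ * _).
    by apply: eq_bigr => j _; rewrite addn1 exprS.
  rewrite -[(2 + 2 * l)%N]/(2 * l).+2 dimVS 2![(-1) ^+ _]exprS [(-1) ^+ _]exprM.
  rewrite sqrrN !expr1n exprS.
  by field; rewrite q2.
(* Here (1 + t)(1 - t)(1 - qt) = 1 - qt - t^2 + qt^3, and the dimension is a combination of the k-th
   powers of -1, 1 and q. *)
apply: (@series_eq_frac_cubic _ _ 1 (- q) 0 2 (- q) (- 1) q).
- by rewrite -!mul_polyC; ring.
- by rewrite -!mul_polyC; ring.
- by [].
- by rewrite dimVS dimV0; field; rewrite ?q2.
- by rewrite !dimVS dimV0; field; rewrite ?q2.
- by rewrite !dimVS dimV0; field; rewrite ?q2.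
by move=> n; rewrite !dimVS !exprS; field; rewrite ?q2.
Qed.
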